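(* Let $X=\mathbb{R}^m$ with the Euclidean norm, $m\in\mathbb{N}$, let $A:X\to 2^X$ be maximally monotone, and let $f:X\to\mathbb{R}$ be fully Legendre. Then for each $x_0\in X$, each sequence $(\lambda_n)_{n=0}^{\infty}$ of positive numbers and each sequence $(\eta_n)_{n=1}^{\infty}$ of vectors in $X$, there exists a unique sequence $(x_n)_{n=1}^{\infty}$ of elements of $X$ such that $$\eta_{n+1}+\nabla f(x_n)\in\lambda_nA(x_{n+1})+\nabla f(x_{n+1}),\quad\forall n\in\mathbb{N}\cup\{0\}.$$ Moreover, $x_{n+1}=(\nabla f+\lambda_nA)^{-1}(\eta_{n+1}+\nabla f(x_n))$ for all $n\in\mathbb{N}\cup\{0\}$.
   Context: $X$ is identified with its dual via the inner product. A function $f:X\to(-\infty,\infty]$ is called fully Legendre if it is lower semicontinuous, convex and Gâteaux differentiable (hence finite) on all of $X$, and its convex conjugate $f^*(x^* )=\sup\{\langle x^*,x\rangle-f(x):x\in X\}$ is Gâteaux differentiable (hence finite) on all of $X$. A set-valued operator $A:X\to 2^{X}$ is monotone if $\langle x_1^*-x_2^*,x_1-x_2\rangle\ge 0$ whenever $x_1^*\in Ax_1$, $x_2^*\in Ax_2$; it is maximally monotone if its graph is not properly contained in the graph of another monotone operator. For $B:X\to 2^{X}$, $B^{-1}(w)=\{x\in X:w\in Bx\}$. Sums of sets are Minkowski sums (empty if one summand is empty), and $(A+B)x=Ax+Bx$, $(\lambda A)(x)=\lambda A(x)$. Under the assumptions here, $(\nabla f+\lambda A)^{-1}(w)$ is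 a singleton for every $\lambda>0$ and $w\in X$, identified with its element. *)

(* Defs.v *)
From HB Require Import structures.
From mathcomp Require Import all_boot all_order all_algebra.
From mathcomp Require Import all_classical all_reals all_analysis.

Set Implicit Arguments.
Unset Strict Implicit.
Unset Printing Implicit Defensive.

Import Order.TTheory GRing.Theory Num.Theory.
Import numFieldNormedType.Exports.

Local Open Scope classical_set_scope.
Local Open Scope ring_scope.

(* R^m is 'rV[R]_m. The norm of the library on 'rV[R]_m is the sup norm; it
   is used below only through the topology it induces, which is also that of
   the Euclidean norm. *)

Definition dotp (R : realType) (m : nat) (u v : 'rV[R]_m) : R :=
  \sum_(i < m) u 0 i * v 0 i.

(* Operators X -> 2^X are functions 'rV[R]_m -> set 'rV[R]_m. *)

Definition op_graph (T : Type) (A : T -> set T) : set (T * T) :=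
  [set p | A p.1 p.2].

Definition monotone_op (R : realType) (m : nat)
    (A : 'rV[R]_m -> set 'rV[R]_m) : Prop :=
  forall x1 x2 u1 u2, A x1 u1 -> A x2 u2 -> 0 <= dotp (u1 - u2) (x1 - x2).

Definition maximally_monotone (R : realType) (m : nat)
    (A : 'rV[R]_m -> set 'rV[R]_m) : Prop :=
  monotone_op A /\
  forall B : 'rV[R]_m -> set 'rV[R]_m, monotone_op B -> ~ (op_graph A `<` op_graph B).

Definition op_add (R : realType) (m : nat) (A B : 'rV[R]_m -> set 'rV[R]_m) :
    'rV[R]_m -> set 'rV[R]_m :=
  fun x => [set a + b | a in A x & b in B x].

Definition op_scale (R : realType) (m : nat) (l : R)
    (A : 'rV[R]_m -> set 'rV[R]_m) : 'rV[R]_m -> set 'rV[R]_m :=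
  fun x => [set l *: a | a in A x].

Definition op_inv (R : realType) (m : nat) (B : 'rV[R]_m -> set 'rV[R]_m) :
    'rV[R]_m -> set 'rV[R]_m :=
  fun w => [set x | B x w].

Definition op_of_fun (R : realType) (m : nat) (g : 'rV[R]_m -> 'rV[R]_m) :
    'rV[R]_m -> set 'rV[R]_m :=
  fun x => [set g x].

(* The Gateaux derivative v |-> 'D_v f x is required to be a linear form,
   represented by g through the inner product. *)
Definition is_gradient (R : realType) (m : nat) (f : 'rV[R]_m -> R)
    (x g : 'rV[R]_m) : Prop :=
  forall v : 'rV[R]_m, is_derive x v f (dotp g v).

Definition gateaux_differentiable (R : realType) (m : nat)
    (f : 'rV[R]_m -> R) (x : 'rV[R]_m) : Prop :=
  exists g, is_gradient f x g.

(* Junk value where f is not Gateaux differentiable. *)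
Definition grad (R : realType) (m : nat) (f : 'rV[R]_m -> R)
    (x : 'rV[R]_m) : 'rV[R]_m :=
  get [set g | is_gradient f x g].

Definition econvex (R : realType) (m : nat) (f : 'rV[R]_m -> \bar R) : Prop :=
  forall (x y : 'rV[R]_m) (t : R), 0 < t < 1 ->
    (f (t *: x + (1 - t) *: y)%R <= t%:E * f x + (1 - t)%R%:E * f y)%E.

Definition conjugate (R : realType) (m : nat) (f : 'rV[R]_m -> \bar R) :
    'rV[R]_m -> \bar R :=
  fun y => ereal_sup [set ((dotp y x)%:E - f x)%E | x in [set: 'rV[R]_m]].

Definition egateaux_differentiable_everywhere (R : realType) (m : nat)
    (f : 'rV[R]_m -> \bar R) : Prop :=
  (forall x, f x \is a fin_num) /\
  (forall x, gateaux_differentiable (fine \o f) x).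

Definition fully_legendre (R : realType) (m : nat)
    (f : 'rV[R]_m -> \bar R) : Prop :=
  [/\ forall x, (-oo < f x)%E,
      lower_semicontinuous f,
      econvex f,
      egateaux_differentiable_everywhere f &
      egateaux_differentiable_everywhere (conjugate f)].

(* Main.v *)
(** Write [F] for the convex conjugate of [f].

    Uniqueness of each step: monotonicity forces
      [<grad f x - grad f y, x - y> <= 0]
    for two solutions, hence equality in the Fenchel-Young inequalities, so that
    both [x] and [y] equal the gradient of [F] at [grad f x].

    Existence is convex duality plus compactness, with no fixed-point theorem.
    For a monotone set [S] of pairs [(a, b)] one finds [(y, z)] with
      [f y + F (- z) + <z, a> + <y, b> <= <a, b>]  for all [(a, b)] in [S].
    For finite [S] it is read off from the optimality conditions of
      [sum t_i <a_i, b_i> + f (sum t_i a_i) + F (- sum t_i b_i)]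
    on the simplex; each of the inequalities defines a compact set because [f]
    and [F] are everywhere finite and are suprema of affine functions, and the
    finite intersection property gives the general case. By Fenchel-Young,
      [<a - y, b - z> >= f y + F (- z) + <z, y> >= 0],
    so maximality puts [(y, z)] in [S]; taking [(a, b) = (y, z)] then forces
    equality in Fenchel-Young, that is [- z = grad f y]. *)

Require Import Defs.
From HB Require Import structures.
From mathcomp Require Import all_boot all_order all_algebra.
From mathcomp Require Import all_classical all_reals all_analysis.
From mathcomp Require Import finmap lra.

Set Implicit Arguments.
Unset Strict Implicit.
Unset Printing Implicit Defensive.

Import Order.TTheory GRing.Theory Num.Theory.
Import numFieldNormedType.Exports.

Local Open Scope classical_set_scope.
Local Open Scope ring_scope.

(** * Euclidean inner product, half-spaces and boxes *)

Section InnerProduct.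
Context {R : realType} {m : nat}.
Implicit Types u v w : 'rV[R]_m.

Lemma dotpE u v : dotp u v = (u *m v^T) 0 0.
Proof. by rewrite mxE; apply: eq_bigr => i _; rewrite mxE. Qed.

Lemma dotpC u v : dotp u v = dotp v u.
Proof. by apply: eq_bigr => i _; rewrite mulrC. Qed.

Lemma dotpDl u v w : dotp (u + v) w = dotp u w + dotp v w.
Proof. by rewrite !dotpE mulmxDl mxE. Qed.

Lemma dotpNl u w : dotp (- u) w = - dotp u w.
Proof. by rewrite !dotpE mulNmx mxE. Qed.

Lemma dotpZl k u w : dotp (k *: u) w = k * dotp u w.
Proof. by rewrite !dotpE -scalemxAl mxE. Qed.

Lemma dotpDr u v w : dotp w (u + v) = dotp w u + dotp w v.
Proof. by rewrite ![dotp w _]dotpC dotpDl. Qed.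

Lemma dotpNr u w : dotp w (- u) = - dotp w u.
Proof. by rewrite ![dotp w _]dotpC dotpNl. Qed.

Lemma dotpZr k u w : dotp w (k *: u) = k * dotp w u.
Proof. by rewrite ![dotp w _]dotpC dotpZl. Qed.

Lemma dotp0r w : dotp w 0 = 0.
Proof. by rewrite -(scale0r 0) dotpZr mul0r. Qed.

Definition dotp_lin :=
  (dotpDl, dotpDr, dotpNl, dotpNr, dotpZl, dotpZr).

Lemma dotp_delta i u : dotp (delta_mx 0 i) u = u 0 i.
Proof.
rewrite /dotp (bigD1 i)//= big1 ?mxE ?eqxx ?mul1r ?addr0// => j ji.
by rewrite mxE (negPf ji) andbF mul0r.
Qed.

Lemma dotp_eq0 u : (forall v, dotp u v <= 0) -> u = 0.
Proof.
move=> u0; apply/rowP => i; rewrite mxE -dotp_delta dotpC.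
have := u0 (delta_mx 0 i); have := u0 (- delta_mx 0 i).
rewrite dotpNr; lra.
Qed.

Lemma dotp_continuous v : continuous (fun u => dotp u v).
Proof.
apply: continuous_big => [|i _].
  exact: pseudometric_normed_Zmodule.add_continuous.
move=> u; exact: (cvgM (@coord_continuous R 1 m 0 i u) (cvg_cst (v 0 i))).
Qed.

Lemma closed_halfspace v (c : R) : closed [set u | dotp u v <= c].
Proof.
apply: (@closed_comp _ _ _ [set r : R | r <= c]); last exact: closed_le.
by move=> u _; exact: dotp_continuous.
Qed.

Lemma compact_box (lo hi : 'I_m -> R) :
  compact [set u : 'rV[R]_m | forall i, lo i <= u 0 i <= hi i].
Proof.
rewrite (_ : mkset _ =
  [set u : 'rV[R]_m | forall i, `[lo i, hi i]%classic (u 0 i)]).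
  apply: (@rV_compact R m (fun i => `[lo i, hi i]%classic)) => i.
  exact: segment_compact.
by apply/seteqP; split=> u /= uM i; move: (uM i); rewrite in_itv.
Qed.

End InnerProduct.

(** * A derivative inequality and compactness tools *)

Lemma dotp_mulmxl (R : realType) (n m : nat) (t : 'rV[R]_n) (a : 'M[R]_(n, m))
  (z : 'rV[R]_m) : dotp (t *m a) z = dotp t (z *m a^T).
Proof. by rewrite !dotpE trmx_mul trmxK mulmxA. Qed.

(** Limit of difference quotients as [h] tends to 0 from above. Two functions with their own base
    points and directions occur because the simplex problem adds [f] and [F] along different linear
    maps; a constant second function covers a single derivative. *)
Lemma is_derive_add_ge (R : realType) (V : normedModType R) (f g : V -> R)
    (x v y w : V) (d e k : R) :
  is_derive x v f d -> is_derive y w g e ->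
  (forall h, 0 < h < 1 ->
     k * h <= f (x + h *: v) - f x + (g (y + h *: w) - g y)) ->
  k <= d + e.
Proof.
move=> [cf df] [cg dg] H.
have {}cf := cvg_dnbhs_at_right cf; have {}cg := cvg_dnbhs_at_right cg.
rewrite -/(derive f x v) df in cf; rewrite -/(derive g y w) dg in cg.
apply: (closed_cvg (fun r => k <= r) (@closed_ge _ k) _ _ (cvgD cf cg)).
near=> h => /=.
have h0 : 0 < h by near: h; exact: nbhs_right_gt.
have h1 : h < 1 by near: h; exact: nbhs_right_lt.
rewrite fctE -scalerDr [_ *: _]mulrC ler_pdivlMr// [_ + x]addrC [_ + y]addrC.
by apply: H; rewrite h0.
Unshelve. all: by end_near. Qed.

Lemma compact_bigcap_seq (T : topologicalType) (I : choiceType) (K : set T)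
    (D : set I) (g : I -> set T) :
  compact K -> (forall i, D i -> closed (g i)) ->
  (forall s : seq I, {in s, forall i, D i} ->
     exists2 x, K x & {in s, forall i, g i x}) ->
  exists x, forall i, D i -> K x /\ g i x.
Proof.
(* The empty sequence supplies a point, which makes [T] pointed. *)
move=> cK gcl gs; have [//|x0 _ _] := gs [::].
pose Tp : ptopologicalType := HB.pack T (isPointed.Build T x0).
have {}cK : @compact Tp K := cK.
move: cK; rewrite compact_In0 => cK.
have [||x xD] := cK I D (fun i => K `&` g i).
- by exists g.
- move=> D' D'D; have [i /D'D/set_mem//|x Kx gx] := gs D'.
  by exists x => i /= iD'; split=> //; exact: gx.
by exists x => i /xD.
Qed.

(** Finitely many of the sublevel sets at levels [h k], [k] in [K], share the [k] of least level; by
    compactness all of them share a point of [K], which is a minimizer. *)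
Lemma compact_argmin (T : ptopologicalType) (R : realDomainType) (K : set T)
    (h : T -> R) :
  compact K -> K !=set0 -> (forall c, closed [set x | h x <= c]) ->
  exists2 x, K x & forall y, K y -> h x <= h y.
Proof.
move=> cK [k0 Kk0] hcl.
have [//|s sK|x xK] :=
    @compact_bigcap_seq T T K K (fun k => [set x | h x <= h k]) cK.
  elim: s sK => [_|a s IH aK]; first by exists k0.
  have [j js|k Kk hk] := IH; first by apply: aK; rewrite inE js orbT.
  have Ka : K a by apply: aK; rewrite mem_head.
  have [ka|/ltW ak] := leP (h k) (h a).
    by exists k => // j; rewrite inE => /orP[/eqP->|/hk].
  exists a => // j; rewrite inE => /orP[/eqP->//=|/hk]; exact: le_trans.
by exists x => [|y /xK[]//]; have [] := xK _ Kk0.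
Qed.

(** * Real-valued conjugate pairs and their gradients *)

Section ConjugatePair.
Context {R : realType} {m : nat}.
Implicit Types (f F : 'rV[R]_m -> R) (x y w g : 'rV[R]_m).

(** Fenchel-Young plus leastness of both suprema: each function is the conjugate of the other. The
    symmetric form lets results be reused with [f] and [F] exchanged. *)
Definition conj_pair f F :=
  [/\ forall w x, dotp w x <= f x + F w,
      forall w c, (forall x, dotp w x - f x <= c) -> F w <= c &
      forall x c, (forall w, dotp w x - F w <= c) -> f x <= c].

Lemma conj_pair_sym f F : conj_pair f F -> conj_pair F f.
Proof.
move=> [H1 H2 H3]; split=> [w x|w c h|w c h].
- by rewrite dotpC addrC.
- by apply: H3 => x; rewrite dotpC.
- by apply: H2 => x; rewrite dotpC.
Qed.

Lemma gradP f x : gateaux_differentiable f x -> is_gradient f x (grad f x).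
Proof. exact: getPex. Qed.

Lemma convex_gradient_le f x g y :
  (forall a b t, 0 < t < 1 ->
     f (t *: a + (1 - t) *: b) <= t * f a + (1 - t) * f b) ->
  is_gradient f x g -> f x + dotp g (y - x) <= f y.
Proof.
move=> cf /(_ (y - x)) fg.
suff : f x - f y <= - dotp g (y - x) + 0 by lra.
apply: (is_derive_add_ge (is_deriveN fg) (is_derive_cst 0 0 0)) => h h01.
have := cf y x h h01; rewrite !fctE subrr addr0.
have -> : h *: y + (1 - h) *: x = x + h *: (y - x).
  by rewrite scalerBl scale1r scalerBr addrCA.
lra.
Qed.

(** Both functions are suprema of affine ones; this presents the sublevel sets met below as
    intersections of half-spaces, hence closed. *)
Lemma conj_pair_sum_leP f F x w c : conj_pair f F ->
  f x + F w <= c <->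
  forall z y, dotp z x - F z + (dotp w y - f y) <= c.
Proof.
move=> [H1 H2 H3]; split=> [fFc z y|zy].
  have := H1 z x; have := H1 w y; lra.
rewrite -lerBrDr; apply: H3 => z.
rewrite lerBrDl -lerBrDr; apply: H2 => y; have := zy z y; lra.
Qed.

Lemma conj_pair_gradient f F x g :
  conj_pair f F -> is_gradient f x g -> f x + F g = dotp g x.
Proof.
move=> [H1 H2 H3] fg; apply/eqP; rewrite eq_le H1 andbT -lerBrDl.
apply: H2 => y; suff : f x + dotp g (y - x) <= f y.
  by rewrite !dotp_lin; lra.
(* [f] is convex as a supremum of affine functions. *)
apply: (convex_gradient_le y _ fg) => a b t t01.
apply: H3 => w; rewrite !dotp_lin.
have := H1 w a; have := H1 w b; nra.
Qed.

(** Equality makes [w] a subgradient at [x], so in the limit [<w - g, v> <= 0] for every [v]. *)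
Lemma conj_pair_gradient_uniq f F x w g :
  conj_pair f F -> f x + F w = dotp w x -> is_gradient f x g -> w = g.
Proof.
move=> [H1 _ _] fFwx fg; apply/eqP; rewrite -subr_eq0; apply/eqP.
apply: dotp_eq0 => v; rewrite dotpDl dotpNl subr_le0.
rewrite -[leRHS]addr0; apply: (is_derive_add_ge (fg v)
  (is_derive_cst 0 0 0)) => h _.
rewrite subrr addr0; have := H1 w (x + h *: v); rewrite !dotp_lin; lra.
Qed.

Lemma fully_legendre_conj_pair f : fully_legendre (fun x => (f x)%:E) ->
  exists F, [/\ conj_pair f F, forall x, gateaux_differentiable f x &
                forall w, gateaux_differentiable F w].
Proof.
move=> [_ _ cf [_ df] [Ffin dF]].
pose F w := fine (conjugate (fun x => (f x)%:E) w).
have FE w : conjugate (fun x => (f x)%:E) w = (F w)%:E by rewrite fineK.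
have H1 w x : dotp w x <= f x + F w.
  rewrite -lerBlDl -lee_fin -FE EFinB.
  by apply: ereal_sup_ubound; exists x.
have H2 w c : (forall x, dotp w x - f x <= c) -> F w <= c.
  move=> h; rewrite -lee_fin -FE; apply: ge_ereal_sup => _ [x _ <-].
  by rewrite -EFinB lee_fin.
exists F; split=> //; split=> // x c h.
have gx := gradP (df x).
(* Biconjugation: the supremum of [<w, x> - F w] reaches [f x] at [w = grad f x]. *)
apply: le_trans (h (grad f x)); rewrite lerBrDr -lerBrDl.
apply: H2 => y; suff : f x + dotp (grad f x) (y - x) <= f y.
  by rewrite !dotp_lin; lra.
apply: (convex_gradient_le y _ gx) => a b t t01.
by have := cf a b t t01; rewrite -!EFinM -EFinD lee_fin.
Qed.

End ConjugatePair.

(** * The standard simplex *)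

Section Simplex.
Context {R : realType} {n : nat}.
Implicit Types t q : 'rV[R]_n.

Definition simplex : set 'rV[R]_n :=
  [set t | (forall i, 0 <= t 0 i) /\ \sum_i t 0 i = 1].

Lemma simplex_compact : compact simplex.
Proof.
have box := @compact_box R n (fun=> 0) (fun=> 1).
apply: subclosed_compact box _; last first.
  move=> t [t0 t1] i /=; rewrite t0 -t1 (bigD1 i)//= lerDl.
  exact: sumr_ge0.
have sum1 t : \sum_i t 0 i = dotp t (const_mx 1).
  by apply: eq_bigr => i _; rewrite mxE mulr1.
rewrite (_ : simplex =
    (\bigcap_i [set t | dotp t (- delta_mx 0 i) <= 0]) `&`
    ([set t | dotp t (const_mx 1) <= 1] `&`
     [set t | dotp t (- const_mx 1) <= -1])).
  apply: closedI; first by apply: closed_bigI => i _; exact: closed_halfspace.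
  by apply: closedI; exact: closed_halfspace.
apply/seteqP; split=> t; rewrite /simplex /= dotpNr lerN2 sum1.
  move=> [t0 ->]; split=> // i _ /=.
  by rewrite dotpNr oppr_le0 dotpC dotp_delta.
move=> [t0 [t1 t1']]; split; last by apply/eqP; rewrite eq_le t1.
by move=> i; have := t0 i I; rewrite /= dotpNr oppr_le0 dotpC dotp_delta.
Qed.

Lemma simplex_dotp_ge t q (k : R) :
  simplex t -> (forall i, k <= q 0 i) -> k <= dotp t q.
Proof.
move=> [t0 t1] kq; rewrite -[k]mul1r -t1 mulr_suml.
by apply: ler_sum => i _; exact: ler_wpM2l.
Qed.

Lemma simplex_vertex i : simplex (delta_mx 0 i).
Proof.
split=> [j|]; first by rewrite mxE ler0n.
rewrite (bigD1 i)//= big1 ?mxE ?eqxx ?addr0// => j ji.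
by rewrite mxE (negPf ji) andbF.
Qed.

Lemma simplex_convex t q (h : R) :
  0 < h < 1 -> simplex t -> simplex q -> simplex (t + h *: (q - t)).
Proof.
move=> h01 [t0 t1] [q0 q1]; split=> [i|].
  by rewrite !mxE; have := t0 i; have := q0 i; nra.
under eq_bigr do rewrite !mxE.
by rewrite big_split/= -mulr_sumr sumrB t1 q1 subrr mulr0 addr0.
Qed.

End Simplex.

(** * Duality for monotone sets *)

Section MonotoneDual.
Context {R : realType} {m : nat} {f F : 'rV[R]_m -> R}.
Hypotheses (fF : conj_pair f F) (df : forall x, gateaux_differentiable f x)
  (dF : forall w, gateaux_differentiable F w).

Lemma mulmx_tr_entry n (a : 'M[R]_(n, m)) (z : 'rV[R]_m) i :
  (z *m a^T) 0 i = dotp z (row i a).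
Proof. by rewrite mxE; apply: eq_bigr => j _; rewrite !mxE. Qed.

(** Averaging [0 <= <b_i - b_j, a_i - a_j>] with weights [t_i t_j] gives twice the claim; [key]
    averages over [i], the last step over [j]. *)
Lemma monotone_simplex_ge n (a b : 'M[R]_(n, m)) (t : 'rV[R]_n) :
  (forall i j, 0 <= dotp (row i b - row j b) (row i a - row j a)) ->
  simplex t ->
  dotp (t *m a) (t *m b) <= dotp t (\row_i dotp (row i a) (row i b)).
Proof.
set c := \row_i _ => mono st.
have key j : - dotp t c <= (c - (t *m a) *m b^T - (t *m b) *m a^T) 0 j.
  have : - c 0 j <= dotp t (c - row j b *m a^T - row j a *m b^T).
    apply: simplex_dotp_ge => // i; rewrite !(mulmx_tr_entry, mxE).
    have := mono i j; rewrite !dotp_lin ![dotp (row _ a) _]dotpC; lra.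
  rewrite 2!dotpDr !dotpNr -!dotp_mulmxl !(mulmx_tr_entry, mxE); lra.
have := simplex_dotp_ge st key.
rewrite 2!dotpDr !dotpNr -!dotp_mulmxl [dotp (t *m b) _]dotpC; lra.
Qed.

(* With t the minimizer of sum_i t_i <a_i, b_i> + f (t a) + F (- t b) over the
   simplex, y = grad F (- t b) and ys = - grad f (t a). *)
Lemma finite_monotone_dual n (a b : 'M[R]_(n.+1, m)) :
  (forall i j, 0 <= dotp (row i b - row j b) (row i a - row j a)) ->
  exists y ys, forall i,
    f y + F (- ys) + dotp ys (row i a) + dotp y (row i b) <=
    dotp (row i a) (row i b).
Proof.
move=> mono; pose c : 'rV[R]_n.+1 := \row_i dotp (row i a) (row i b).
pose phi t := dotp t c + (f (t *m a) + F (- (t *m b))).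
have phi_closed r : closed [set t | phi t <= r].
  rewrite (_ : mkset _ = \bigcap_(p : 'rV[R]_m * 'rV[R]_m)
    [set t | dotp t (c + p.1 *m a^T - p.2 *m b^T) <= r + F p.1 + f p.2]).
    by apply: closed_bigI => p _; exact: closed_halfspace.
  have lin t p : dotp t (c + p.1 *m a^T - p.2 *m b^T) =
      dotp t c + dotp p.1 (t *m a) + dotp (- (t *m b)) p.2.
    rewrite 2!dotpDr dotpNr -!dotp_mulmxl dotpNl.
    by rewrite [dotp (t *m a) _]dotpC.
  apply/seteqP; split=> t.
    move=> tr p _ /=; rewrite lin.
    have [H1 _ _] := fF; have := H1 p.1 (t *m a); have := H1 (- (t *m b)) p.2.
    by move: tr; rewrite /= /phi; lra.
  move=> tr; rewrite /= /phi -lerBrDl.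
  apply/(conj_pair_sum_leP _ _ _ fF) => z y.
  have := tr (z, y) I; rewrite /= (lin t (z, y))/=; lra.
have [t st tmin] := compact_argmin simplex_compact
  (ex_intro _ _ (simplex_vertex ord0)) phi_closed.
set x := t *m a in tmin *; set w := - (t *m b) in tmin *.
have gx := gradP (df x); have gw := gradP (dF w).
set g := grad f x in gx *; set y := grad F w in gw *.
exists y, (- g) => i; rewrite opprK.
have fgx := conj_pair_gradient fF gx.
have fyw := conj_pair_gradient (conj_pair_sym fF) gw.
(* Moving from [t] towards the vertex [i] yields the optimality condition that becomes the [i]-th
   inequality. *)
pose v := delta_mx 0 i - t.
have va : v *m a = row i a - x by rewrite mulmxBl -rowE.
have vb : - (v *m b) = - row i b - w by rewrite mulmxBl -rowE opprB opprK addrC.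
have vc : dotp v c = dotp (row i a) (row i b) - dotp t c.
  by rewrite dotpDl dotpNl dotp_delta mxE.
have : - dotp v c <= dotp g (v *m a) + dotp y (- (v *m b)).
  apply: (is_derive_add_ge (gx _) (gw _)) => h h01.
  have := tmin _ (simplex_convex h01 st (simplex_vertex i)).
  have lin (d : 'M[R]_(n.+1, m)) :
      (t + h *: v) *m d = t *m d + h *: (v *m d).
    by rewrite mulmxDl -scalemxAl.
  rewrite /phi -/v dotpDl dotpZl !lin opprD -scalerN -/x -/w; lra.
(* The two Fenchel equalities reduce the goal to [0 <= <t, c> + f x + F w], which follows from
   [<t, c> >= <x, t b> = - <w, x>]. *)
rewrite vc va vb 2!dotpDr !dotpNr => ineq.
have := monotone_simplex_ge mono st; rewrite -/c -/x => mtc.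
have [/(_ w x) H1 _ _] := fF.
have : dotp x (t *m b) = - dotp w x by rewrite dotpNl opprK dotpC.
have : dotp y w = - dotp y (t *m b) by rewrite dotpNr.
rewrite dotpNl; lra.
Qed.

(** Fenchel-Young at points shifted by [s] along a coordinate axis; [s = 1] and [s = -1] confine
    [(y, ys)] to a box. *)
Lemma dual_bounds (p : 'rV[R]_m * 'rV[R]_m) y ys s i :
  f y + F (- ys) + dotp ys p.1 + dotp y p.2 <= dotp p.1 p.2 ->
  s * y 0 i <= dotp p.1 p.2 + F (s *: delta_mx 0 i - p.2) + f p.1 /\
  s * ys 0 i <= dotp p.1 p.2 + F (- p.2) + f (p.1 - s *: delta_mx 0 i).
Proof.
have [H1 _ _] := fF.
have := H1 (s *: delta_mx 0 i - p.2) y; have := H1 (- ys) p.1.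
have := H1 (- p.2) y; have := H1 (- ys) (p.1 - s *: delta_mx 0 i).
rewrite !dotp_lin dotp_delta [dotp ys (delta_mx _ _)]dotpC dotp_delta.
by rewrite [dotp p.2 y]dotpC => ? ? ? ? ?; split; lra.
Qed.

Lemma monotone_dual (S : set ('rV[R]_m * 'rV[R]_m)) :
  (forall p q, S p -> S q -> 0 <= dotp (p.2 - q.2) (p.1 - q.1)) ->
  exists y ys, forall p, S p ->
    f y + F (- ys) + dotp ys p.1 + dotp y p.2 <= dotp p.1 p.2.
Proof.
move=> mono; have [->|/set0P[p0 Sp0]] := eqVneq S set0.
  by exists 0, 0.
pose T (p : 'rV[R]_m * 'rV[R]_m) := [set q : 'rV[R]_m * 'rV[R]_m |
  f q.1 + F (- q.2) + dotp q.2 p.1 + dotp q.1 p.2 <= dotp p.1 p.2].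
have T_closed p : closed (T p).
  rewrite (_ : T p = \bigcap_(r : 'rV[R]_m * 'rV[R]_m)
    [set q | dotp q.1 (r.1 + p.2) + dotp q.2 (p.1 - r.2) <=
             dotp p.1 p.2 + F r.1 + f r.2]).
    apply: closed_bigI => r _.
    apply: (@closed_comp _ _ _ [set k : R | k <= _]); last exact: closed_le.
    have c1 u : continuous (fun q : 'rV[R]_m * 'rV[R]_m => dotp q.1 u).
      move=> q; apply: continuous_comp (@dotp_continuous R m u _).
      exact: cvg_fst.
    have c2 u : continuous (fun q : 'rV[R]_m * 'rV[R]_m => dotp q.2 u).
      move=> q; apply: continuous_comp (@dotp_continuous R m u _).
      exact: cvg_snd.
    by move=> q _; exact: cvgD (c1 _ q) (c2 _ q).
  apply/seteqP; split=> q /=.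
    have [H1 _ _] := fF; move=> Tq r _ /=.
    have := H1 r.1 q.1; have := H1 (- q.2) r.2; move: Tq.
    by rewrite /T /= !dotp_lin [dotp r.1 _]dotpC; lra.
  move=> rq; rewrite /T /= -lerBrDr -lerBrDr.
  apply/(conj_pair_sum_leP _ _ _ fF) => z y; have := rq (z, y) I.
  by rewrite /= !dotp_lin [dotp z _]dotpC; lra.
have T_compact : compact (T p0).
  pose B i (s : R) :=
    dotp p0.1 p0.2 + F (s *: delta_mx 0 i - p0.2) + f p0.1.
  pose C i (s : R) :=
    dotp p0.1 p0.2 + F (- p0.2) + f (p0.1 - s *: delta_mx 0 i).
  have box := compact_setX
    (@compact_box R m (fun i => - B i (-1)) (fun i => B i 1))
    (@compact_box R m (fun i => - C i (-1)) (fun i => C i 1)).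
  apply: subclosed_compact (T_closed p0) box _.
  move=> q Tq; split=> i.
    have [b1 _] := dual_bounds 1 i Tq; have [b2 _] := dual_bounds (-1) i Tq.
    by apply/andP; rewrite /B; split; lra.
  have [_ b1] := dual_bounds 1 i Tq; have [_ b2] := dual_bounds (-1) i Tq.
  by apply/andP; rewrite /C; split; lra.
have [s sS|[y ys] yP] :=
    @compact_bigcap_seq _ _ (T p0) S T T_compact (fun p _ => T_closed p).
  (* Prepending [p0] makes the family nonempty and places the solution in the compact set [T p0]. *)
  pose s' := p0 :: s.
  have s'S : {in s', forall p, S p}.
    by move=> p; rewrite inE => /orP[/eqP->//|/sS].
  pose a : 'M[R]_((size s).+1, m) := \matrix_i (nth p0 s' i).1.
  pose b : 'M[R]_((size s).+1, m) := \matrix_i (nth p0 s' i).2.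
  have [|y [ys yP]] := @finite_monotone_dual _ a b.
    by move=> i j; rewrite !rowK; apply: mono; apply: s'S; exact: mem_nth.
  have Ts' p : p \in s' -> T p (y, ys).
    rewrite -index_mem => ps; have := yP (Ordinal ps).
    by rewrite !rowK/= -/s' nth_index -?index_mem.
  exists (y, ys); first by apply: Ts'; exact: mem_head.
  by move=> p ps; apply: Ts'; rewrite inE ps orbT.
by exists y, ys => p /yP[].
Qed.

End MonotoneDual.

(** * The resolvent step and the iteration *)

Section Resolvent.
Context {R : realType} {m : nat}.
Implicit Types (f : 'rV[R]_m -> R) (A : 'rV[R]_m -> set 'rV[R]_m).

(** Adjoining [(x, u)] to the graph keeps it monotone. *)
Lemma maximally_monotone_mem A x u : maximally_monotone A ->
  (forall y v, A y v -> 0 <= dotp (v - u) (y - x)) -> A x u.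
Proof.
move=> [mA maxA] xu; pose B y := A y `|` [set v | y = x /\ v = u].
have xu' y v : A y v -> 0 <= dotp (u - v) (x - y).
  by move=> /xu; rewrite -opprB -[x - y]opprB !dotp_lin; lra.
have mB : monotone_op B.
  move=> y1 y2 v1 v2 [A1|[-> ->]] [A2|[-> ->]].
  - exact: mA.
  - exact: xu.
  - exact: xu'.
  - by rewrite !subrr dotp0r.
apply: contrapT => nA; apply: (maxA B mB); split.
  by move=> [y v] Ayv; left.
by move=> /(_ (x, u)); apply: contra_not nA; apply; right.
Qed.

Lemma resolvent_uniq f F A l w x y :
  conj_pair f F -> (forall z, gateaux_differentiable f z) ->
  (forall z, gateaux_differentiable F z) -> monotone_op A -> 0 < l ->
  op_inv (op_add (op_of_fun (grad f)) (op_scale l A)) w x ->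
  op_inv (op_add (op_of_fun (grad f)) (op_scale l A)) w y -> x = y.
Proof.
move=> fF df dF mA l0 [_ -> [_ [u Au <-]] ux] [_ -> [_ [v Av <-]] vy].
have gx := gradP (df x); have gy := gradP (df y).
have guv : grad f x - grad f y = l *: (v - u).
  rewrite scalerBr -[l *: v](addKr (grad f y)) vy -ux.
  by rewrite addrA addrK addrC.
have mono : dotp (grad f x - grad f y) (x - y) <= 0.
  rewrite guv dotpZl -opprB dotpNl mulrN oppr_le0.
  by apply: mulr_ge0; [exact: ltW|exact: mA].
have fx := conj_pair_gradient fF gx; have fy := conj_pair_gradient fF gy.
have [H1 _ _] := fF.
(* The Fenchel-Young inequalities for [(grad f x, y)] and [(grad f y, x)] add up to the reverse of
   [mono], so both are equalities. *)
have eq_y : F (grad f x) + f y = dotp y (grad f x).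
  have := H1 (grad f x) y; have := H1 (grad f y) x; move: mono.
  by rewrite !dotp_lin [dotp y _]dotpC; lra.
have eq_x : F (grad f x) + f x = dotp x (grad f x) by rewrite dotpC addrC.
have Fg := gradP (dF (grad f x)); have Ff := conj_pair_sym fF.
rewrite (conj_pair_gradient_uniq Ff eq_x Fg).
by rewrite (conj_pair_gradient_uniq Ff eq_y Fg).
Qed.

Lemma resolvent_exists f F A l w :
  conj_pair f F -> (forall z, gateaux_differentiable f z) ->
  (forall z, gateaux_differentiable F z) -> maximally_monotone A -> 0 < l ->
  op_inv (op_add (op_of_fun (grad f)) (op_scale l A)) w !=set0.
Proof.
move=> fF df dF maxA l0; have [mA _] := maxA.
(* The graph of [l A - w]: the inclusion asks for a zero of [grad f + l A - w]. *)
pose S : set ('rV[R]_m * 'rV[R]_m) :=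
  [set p | exists2 u, A p.1 u & p.2 = l *: u - w].
have [|y [ys yP]] := @monotone_dual _ _ _ _ fF df dF S.
  move=> p q [u Au ->] [v Av ->].
  rewrite opprB addrA subrK -scalerBr dotpZl.
  by apply: mulr_ge0; [exact: ltW|exact: mA].
have [H1 _ _] := fF; have Hy := H1 (- ys) y.
(* [(y, ys)] is monotonically related to [S]; solving [ys = l u - w] for [u] gives this vector. *)
have Ay : A y (l^-1 *: (ys + w)).
  apply: maximally_monotone_mem => // x u Axu.
  rewrite -(pmulr_rge0 _ l0) -dotpZl scalerBr scalerA divff ?gt_eqF// scale1r.
  have := yP (x, l *: u - w); rewrite /S/= => /(_ (ex_intro2 _ _ u Axu erefl)).
  move: Hy; rewrite !dotp_lin ![dotp x _]dotpC ![dotp y _]dotpC; lra.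
exists y; exists (grad f y) => //; exists (ys + w).
  by exists (l^-1 *: (ys + w)) => //; rewrite scalerA divff ?gt_eqF// scale1r.
suff <- : - ys = grad f y by rewrite addKr.
apply: (conj_pair_gradient_uniq fF _ (gradP (df y))).
apply/eqP; rewrite eq_le Hy andbT.
have /yP : S (y, ys).
  exists (l^-1 *: (ys + w)) => //=.
  by rewrite scalerA divff ?gt_eqF// scale1r addrK.
by rewrite /= [dotp y ys]dotpC dotpNl; lra.
Qed.

End Resolvent.

(* A sequence (x_n)_(n >= 1) is a function x : nat -> 'rV[R]_m with x 0 pinned
   to x0; of the sequence (eta_n)_(n >= 1) only eta n.+1 is used. *)
Theorem theorem7p1 (R : realType) (m : nat) (hm : (0 < m)%N)
    (A : 'rV[R]_m -> set 'rV[R]_m) (hA : maximally_monotone A)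
    (f : 'rV[R]_m -> R) (hf : fully_legendre (fun x => (f x)%:E))
    (x0 : 'rV[R]_m)
    (lambda : nat -> R) (hlambda : forall n, 0 < lambda n)
    (eta : nat -> 'rV[R]_m) :
  exists x : nat -> 'rV[R]_m,
    unique (fun y : nat -> 'rV[R]_m =>
      y 0%N = x0 /\
      forall n : nat,
        op_add (op_scale (lambda n) A) (op_of_fun (grad f)) (y n.+1)
          (eta n.+1 + grad f (y n))) x /\
    forall n : nat,
      op_inv (op_add (op_of_fun (grad f)) (op_scale (lambda n) A))
        (eta n.+1 + grad f (x n)) = [set x n.+1].
Proof.
have [F [fF df dF]] := fully_legendre_conj_pair hf.
pose J n w := op_inv (op_add (op_of_fun (grad f)) (op_scale (lambda n) A)) w.
have J1 n w : exists z, J n w = [set z].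
  have [z Jz] := resolvent_exists w fF df dF hA (hlambda n).
  exists z; apply/seteqP; split=> [y Jy|_ ->//].
  exact: resolvent_uniq fF df dF hA.1 (hlambda n) Jy Jz.
have JE n y w :
    op_add (op_scale (lambda n) A) (op_of_fun (grad f)) y w <-> J n w y.
  by split=> -[a Pa [b Pb <-]]; exists b => //; exists a => //; rewrite addrC.
(* [get] picks the element of a set that [J1] shows to be a singleton. *)
pose x := fix x n := if n is k.+1
  then get (J k (eta k.+1 + grad f (x k))) else x0.
have xS n : J n (eta n.+1 + grad f (x n)) = [set x n.+1].
  have [z Jz] := J1 n (eta n.+1 + grad f (x n)).
  rewrite [x n.+1]/= Jz; congr set1.
  by apply/esym; exact: (getPex (ex_intro [set z] z erefl)).
exists x; split=> //; split.
  by split=> // n; apply/JE; rewrite xS.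
move=> y [y0 yS]; apply/funext; elim=> [//|n IH].
by have /JE := yS n; rewrite -IH xS => ->.
Qed.
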